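(* Let $n\geq2$ have prime decomposition $n=p_1^{k_1}p_2^{k_2}\cdots p_j^{k_j}$ and let $n_0:=p_1^{k_1+1}p_2^{k_2+1}\cdots p_j^{k_j+1}$. Then an integral basis of the pure fields $\mathbb{Q}(\sqrt[n]{m})$, where $m\neq\pm1$ ranges over square-free integers, is repeating periodically modulo $n_0$.
   Context: For an integer $n\geq2$ and a square-free integer $m\neq\pm1$, let $\alpha_m$ be a root of $X^n-m$ and $K_m=\mathbb{Q}(\alpha_m)$ (a field of degree $n$). An integral basis of the fields $K_m$ is said to be repeating periodically modulo $n_0$ if for each residue class $r$ modulo $n_0$ there exist polynomials $h^{(r)}_0(X),\ldots,h^{(r)}_{n-1}(X)\in\mathbb{Q}[X]$ such that whenever $m$ is square-free, $m\neq\pm1$, and $m\equiv r \pmod{n_0}$, the tuple $(h^{(r)}_0(\alpha_m),\ldots,h^{(r)}_{n-1}(\alpha_m))$ is an integral basis (a $\mathbb{Z}$-basis of the ring of integers) of $K_m$. *)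

(* Defs.v *)
From HB Require Import structures.
From mathcomp Require Import all_boot all_order all_algebra all_field.
Set Implicit Arguments. Unset Strict Implicit. Unset Printing Implicit Defensive.
Import Order.TTheory GRing.Theory Num.Theory.
Local Open Scope ring_scope.

(* m : int is square-free: no square d^2 > 1 divides m (so m <> 0). *)
Definition squarefree_int (m : int) : Prop :=
  forall d : nat, (d * d %| `|m|)%N -> d = 1%N.

Definition n0_of (n : nat) : nat :=
  (\prod_(p <- primes n) p ^ (logn p n).+1)%N.

Definition qeval (h : {poly rat}) (a : algC) : algC := (map_poly ratr h).[a].

Definition in_Qa (a x : algC) : Prop := exists h : {poly rat}, x = qeval h a.

Definition integral_basis (n : nat) (a : algC) (b : 'I_n -> algC) : Prop :=
  [/\ (forall i, in_Qa a (b i) /\ b i \in Aint),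
      (forall x, in_Qa a x -> x \in Aint ->
         exists c : 'I_n -> int, x = \sum_(i < n) (c i)%:~R * b i)
    & (forall c : 'I_n -> int,
         \sum_(i < n) (c i)%:~R * b i = 0 -> forall i, c i = 0)].

(* Main.v *)
(* Let [a^n = m] and [a'^n = m'] with [m' = m + n0 t], let [R] be the product of
   the primes dividing [n] times [t], so that [m' - m = n R], and let [h] have degree
   less than [n].  The key point is that [h(a)] is integral iff [h(a')] is, so
   that one basis of the lattice of such [h] serves a whole residue class.
   Lagrange interpolation at the roots [b_i] of [X^n - m] gives
     m h(a') = \sum_i h(b_i) W_i,   W_i = b_i R / (a' - b_i),
   and [W_i] is integral since
     W^n = m \sum_(i >= 1) ('C(n, i) R^(i-1) / n) W^(n-i)
   has integer coefficients: the exponents [k_p + 1] in [n0] are what makes [n]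
   divide ['C(n, i) R^(i-1)].  The factor [m] is then removed with an
   Eisenstein argument: at a prime [q | m], [q^2] not dividing [m], a combination of
   the powers of [a] divisible by [q] has all its coefficients divisible by [q]. *)
Require Import Defs.
From HB Require Import structures.
From mathcomp Require Import all_boot all_order all_algebra all_field.
From mathcomp Require Import ring zify.
From Stdlib Require Import Classical_Prop.
Import Order.TTheory GRing.Theory Num.Theory.
Local Open Scope ring_scope.

(** * Integrality and the Eisenstein step *)

Lemma Aint_int_root (n : nat) (m : int) (a : algC) :
  (0 < n)%N -> a ^+ n = m%:~R -> a \in Aint.
Proof.
move=> n0 am; apply: (@root_monic_Aint ('X^n - (m%:~R)%:P)).
- by rewrite rootE !hornerE am subrr.
- by rewrite monicXnsubC.
- by rewrite polyOverXnsubC rpred_int.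
Qed.

(* Take the least [i] violating the conclusion and multiply by [a ^+ (n - 1 - i)]:
   all other terms become divisible by [q], hence so does [P`_i a ^+ (n - 1)], and
   its [n]-th power [P`_i ^+ n * m ^+ (n - 1)] has too small a [q]-valuation. *)
Lemma Aint_Eisenstein_step (n : nat) (m : int) (a : algC) (q : nat) (P : {poly int})
    (y : algC) :
  (0 < n)%N -> a ^+ n = m%:~R -> prime q -> (q %| `|m|)%N -> ~~ (q * q %| `|m|)%N ->
  (size P <= n)%N -> y \in Aint -> (map_poly intr P).[a] = q%:R * y ->
  forall i, (q%:Z %| P`_i)%Z.
Proof.
move=> n0 am qP qm q2m sP yA PaE.
have aA := Aint_int_root _ _ _ n0 am.
have [k mk] : exists k : int, m = q%:Z * k.
  by exists (m %/ q%:Z)%Z; rewrite mulrC divzK.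
elim/ltn_ind=> i IH.
have [ni|lin] := leqP n i.
  by rewrite nth_default ?dvdz0 // (leq_trans sP).
set c := P`_i.
have [z zA cz] : exists2 z, z \in Aint & c%:~R * a ^+ n.-1 = q%:R * z.
  have E : c%:~R * a ^+ n.-1 = q%:R * y * a ^+ (n.-1 - i)
     - \sum_(j < n | j != Ordinal lin) (P`_j)%:~R * a ^+ j * a ^+ (n.-1 - i).
    rewrite -PaE (horner_coef_wide _ (n := n)); last by rewrite (leq_trans (size_poly _ _)).
    rewrite (bigD1 (Ordinal lin)) //= mulrDl mulr_suml.
    rewrite coef_map /= -/c -mulrA -exprD subnKC; last by case: (n) lin.
    rewrite [X in _ - X](eq_bigr (fun j : 'I_n => (map_poly intr P)`_j * a ^+ j * a ^+ (n.-1 - i))).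
      by rewrite addrK.
    by move=> j _; rewrite coef_map.
  have [S SA SE] : exists2 S, S \in Aint &
     \sum_(j < n | j != Ordinal lin) (P`_j)%:~R * a ^+ j * a ^+ (n.-1 - i) = q%:R * S.
    apply: (big_ind (fun x => exists2 S, S \in Aint & x = q%:R * S)).
    - by exists 0; rewrite ?mulr0 ?rpred0.
    - move=> _ _ [s1 A1 ->] [s2 A2 ->]; exists (s1 + s2); first exact: rpredD.
      by rewrite mulrDr.
    (* Below [i] the coefficient supplies the factor [q], by minimality of [i]. Above [i] the
       exponent [j + (n - 1 - i)] is at least [n], and [a^n = m] supplies it. *)
    move=> j ji; have [lji|] := ltnP j i.
      exists ((P`_j %/ q%:Z)%Z%:~R * a ^+ j * a ^+ (n.-1 - i)).
        by rewrite !rpredM ?rpredX ?Aint_int.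
      by rewrite -{1}(divzK (IH _ lji)) rmorphM /= -pmulrn; ring.
    rewrite leq_eqVlt => /orP[/eqP E1|lij].
      by case/eqP: ji; apply/val_inj.
    exists ((P`_j)%:~R * k%:~R * a ^+ (j - i.+1)).
      by rewrite !rpredM ?rpredX ?Aint_int.
    rewrite -mulrA -exprD.
    have -> : (j + (n.-1 - i) = n + (j - i.+1))%N by have := ltn_ord j; lia.
    by rewrite exprD am mk rmorphM /= -pmulrn; ring.
  exists (y * a ^+ (n.-1 - i) - S); first by rewrite rpredB ?rpredM ?rpredX.
  by rewrite E SE; ring.
have q0 : (q%:R : algC) != 0 by rewrite pnatr_eq0 -lt0n prime_gt0.
have zn : z ^+ n * (q ^ n)%:R = (c ^+ n * m ^+ n.-1)%:~R.
  rewrite natrX -exprMn mulrC -cz exprMn -exprM mulnC exprM am.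
  by rewrite rmorphM /= !rmorphXn.
(* [z^n] is rational and integral, hence an integer: the divisibility by [q^n] descends to the
   integers. *)
have /intrP[d dE] : z ^+ n \is a Num.int.
  apply: Cint_rat_Aint; last exact: rpredX.
  rewrite -[z ^+ n](mulfK (x := (q ^ n)%:R)) ?zn; last by rewrite natrX expf_neq0.
  by rewrite rpred_div ?rpred_int ?rpred_nat.
have {}zn : (c ^+ n * m ^+ n.-1) = d * (q ^ n)%:Z.
  apply: (intr_inj (R := algC)); rewrite -zn dE rmorphM /= -pmulrn //.
have q_dvd : (q ^ n %| `|c| ^ n * `|m| ^ n.-1)%N.
  by rewrite -!abszX -abszM zn abszM /= dvdn_mull.
(* With [m = q k] and [q] prime to [k], cancelling [q^(n-1)] leaves [q] dividing [c^n k^(n-1)],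
   which forces [q] to divide [c]. *)
rewrite dvdzE; apply: contraLR q_dvd => qc.
have qkn : ~~ (q %| `|k|)%N.
  by apply: contra q2m => qk; rewrite mk abszM /= dvdn_mul.
rewrite mk abszM /= expnMn mulnCA -{1}(prednK n0) expnS mulnC dvdn_pmul2l ?expn_gt0 ?prime_gt0 //.
by rewrite Euclid_dvdM // !Euclid_dvdX // (negPf qc) (negPf qkn).
Qed.

(** * Square-free [m]: independence of the powers of [a], denominators prime to [m] *)

Lemma squarefree_prime (m : int) (q : nat) :
  squarefree_int m -> prime q -> ~~ (q * q %| `|m|)%N.
Proof. by move=> sqf qP; apply/negP=> /sqf q1; rewrite q1 in qP. Qed.

Lemma squarefree_neq0 (m : int) : squarefree_int m -> m != 0.
Proof. by move=> sqf; apply/eqP=> m0; have := sqf 2%N; rewrite m0 dvdn0 => /(_ isT). Qed.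

Lemma squarefree_prime_div (m : int) : squarefree_int m -> m != 1 -> m != -1 ->
  exists2 q, prime q & (q %| `|m|)%N.
Proof.
move=> sqf m1 mN1; exists (pdiv `|m|); last exact: pdiv_dvd.
apply: pdiv_prime; have := squarefree_neq0 _ sqf; lia.
Qed.

Lemma map_ratr_intr (P : {poly int}) :
  map_poly ratr (map_poly intr P : {poly rat}) = map_poly intr P :> {poly algC}.
Proof. by apply/polyP=> i; rewrite !coef_map /= ratr_int. Qed.

Lemma dvdz_poly_scale (q : nat) (P : {poly int}) :
  (0 < q)%N -> (forall i, (q%:Z %| P`_i)%Z) ->
  exists2 P' : {poly int}, P = q%:Z *: P' & size P' = size P.
Proof.
move=> q0 qP; pose P' := \poly_(i < size P) (P`_i %/ q%:Z)%Z.
have E : P = q%:Z *: P'.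
  apply/polyP=> i; rewrite coefZ coef_poly; case: ltnP => iP.
    by rewrite mulrC divzK.
  by rewrite nth_default ?mulr0.
by exists P' => //; rewrite [in RHS]E size_scale // -lt0n.
Qed.

(** Plays the part of the irreducibility of [X^n - m]. By the Eisenstein step with value 0, a prime
    [q] dividing [m] divides every coefficient; dividing by [q] lowers the absolute value of the
    leading coefficient, so a nonzero [P] would descend forever. *)
Lemma int_poly_root_eq0 (n : nat) (m : int) (a : algC) (P : {poly int}) :
  (0 < n)%N -> a ^+ n = m%:~R -> squarefree_int m -> m != 1 -> m != -1 ->
  (size P <= n)%N -> (map_poly intr P).[a] = 0 -> P = 0.
Proof.
move=> n0 am sqf m1 mN1 sP Pa.
have [q qP qm] := squarefree_prime_div _ sqf m1 mN1.
have q2m := squarefree_prime _ _ sqf qP.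
have [N leN] := ubnP `|lead_coef P|; elim: N P sP Pa leN => // N IH P sP Pa leN.
apply/eqP/negPn/negP=> P0; have lP0 : lead_coef P != 0 by rewrite lead_coef_eq0.
have qPi : forall i, (q%:Z %| P`_i)%Z.
  apply: (Aint_Eisenstein_step n m a q P 0 n0 am qP qm q2m sP Aint0).
  by rewrite mulr0.
have [P' PE sP'] := dvdz_poly_scale _ _ (prime_gt0 qP) qPi.
case/eqP: P0; rewrite PE (IH P') ?scaler0 ?sP' //.
  have : q%:R * (map_poly intr P').[a] = 0 by rewrite -Pa PE map_polyZ hornerZ /= -pmulrn.
  by move/eqP; rewrite mulf_eq0 pnatr_eq0 -[q == 0%N]negbK -lt0n prime_gt0 //= => /eqP.
move: lP0 leN; rewrite PE lead_coefZ abszM /= => l0 leN.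
move: leN; rewrite ltnS; apply: leq_trans; rewrite -[X in (X < _)%N]mul1n ltn_mul2r prime_gt1 // andbT.
by rewrite lt0n absz_eq0; apply: contraNneq l0 => ->; rewrite mulr0.
Qed.

Lemma qeval_scale (c : rat) (h : {poly rat}) (a : algC) :
  qeval (c *: h) a = ratr c * qeval h a.
Proof. by rewrite /qeval map_polyZ hornerZ. Qed.

Lemma qeval_int (P : {poly int}) (a : algC) :
  qeval (map_poly intr P) a = (map_poly intr P).[a].
Proof. by rewrite /qeval map_ratr_intr. Qed.

Lemma rat_poly_denom (h : {poly rat}) :
  exists D : nat, exists2 P : {poly int}, (0 < D)%N & D%:R *: h = map_poly intr P.
Proof.
have [P [d d0 ->]] := rat_poly_scale h.
exists `|d|%N; exists (Num.sg d *: P); first by rewrite lt0n absz_eq0.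
apply/polyP=> i; rewrite !(coefZ, coef_map) /= rmorphM /= mulrA; congr (_ * _).
have dE : (`|d|%N%:R : rat) = d%:~R * (Num.sg d)%:~R.
  by rewrite -rmorphM mulrC -normrEsg -abszE.
by rewrite dE mulrAC mulfV ?mul1r // intr_eq0.
Qed.

Lemma size_int_multiple (D : nat) (h : {poly rat}) (P : {poly int}) :
  D%:R *: h = map_poly intr P -> (size P <= size h)%N.
Proof.
move=> DE; apply/leq_sizeP => j hj; apply/eqP; rewrite -(intr_eq0 rat).
by move/polyP: DE => /(_ j); rewrite coefZ coef_map /= => <-; rewrite nth_default // mulr0.
Qed.

Lemma rat_poly_root_eq0 (n : nat) (m : int) (a : algC) (h : {poly rat}) :
  (0 < n)%N -> a ^+ n = m%:~R -> squarefree_int m -> m != 1 -> m != -1 ->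
  (size h <= n)%N -> qeval h a = 0 -> h = 0.
Proof.
move=> n0 am sqf m1 mN1 sh ha; have [D [P D0 DE]] := rat_poly_denom h.
have P0 : P = 0.
  apply: (int_poly_root_eq0 n m a) => //.
    exact: leq_trans (size_int_multiple _ _ _ DE) sh.
  by rewrite -qeval_int -DE qeval_scale ha mulr0.
apply/eqP; move/eqP: DE; rewrite P0 map_poly0 scale_poly_eq0 pnatr_eq0.
by rewrite -[D == 0%N]negbK -lt0n D0.
Qed.

(** Descent on the denominator: if a prime [q] divides both [D] and [m], then [P(a) = q (D/q) h(a)],
    so the Eisenstein step lets [q] be cancelled from [D] and [P]. *)
Lemma rat_poly_coprime_denom (n : nat) (m : int) (a : algC) (h : {poly rat}) :
  (0 < n)%N -> a ^+ n = m%:~R -> squarefree_int m ->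
  (size h <= n)%N -> qeval h a \in Aint ->
  exists D : nat, exists2 P : {poly int},
    coprime D `|m| & D%:R *: h = map_poly intr P.
Proof.
move=> n0 am sqf sh hA; have [D [P D0 DE]] := rat_poly_denom h.
have m0 : (0 < `|m|)%N by rewrite lt0n absz_eq0 squarefree_neq0.
elim/ltn_ind: D => D IH in P D0 DE *.
have [cDm|] := boolP (coprime D `|m|); first by exists D, P.
rewrite /coprime => g1; pose q := pdiv (gcdn D `|m|).
have qP : prime q.
  apply: pdiv_prime; have : (0 < gcdn D `|m|)%N by rewrite gcdn_gt0 D0.
  by case: gcdn g1 => [|[]].
have := pdiv_dvd (gcdn D `|m|); rewrite -/q dvdn_gcd => /andP[qD qm].
have PaE : (map_poly intr P).[a] = q%:R * ((D %/ q)%:R * qeval h a).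
  by rewrite mulrA -natrM mulnC divnK // -qeval_int -DE qeval_scale ratr_nat.
have qPi : forall i, (q%:Z %| P`_i)%Z.
  apply: (Aint_Eisenstein_step n m a q P _ n0 am qP qm _ _ _ PaE).
  - exact: squarefree_prime.
  - exact: leq_trans (size_int_multiple _ _ _ DE) sh.
  - by rewrite rpredM ?rpred_nat.
have [P' PE _] := dvdz_poly_scale _ _ (prime_gt0 qP) qPi.
apply: (IH (D %/ q)%N _ P'); first by rewrite ltn_Pdiv ?prime_gt1.
  by rewrite divn_gt0 ?prime_gt0 // dvdn_leq.
have q0 : (q%:R : rat) != 0 by rewrite pnatr_eq0 -lt0n prime_gt0.
apply: (scalerI q0); rewrite scalerA -natrM mulnC divnK // DE PE map_polyZ.
by rewrite /= -pmulrn.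
Qed.

(** * Conjugates and Lagrange interpolation *)

(** If [p] is the minimal polynomial of [h(a)], then [p] composed with [h] vanishes at [a], so
    [X^n - m] divides it and [h(b)] is a root of [p] as well. *)
Lemma qeval_conj_Aint (n : nat) (m : int) (a b : algC) (h : {poly rat}) :
  (0 < n)%N -> a ^+ n = m%:~R -> b ^+ n = m%:~R ->
  squarefree_int m -> m != 1 -> m != -1 ->
  qeval h a \in Aint -> qeval h b \in Aint.
Proof.
move=> n0 am bm sqf m1 mN1 hA.
have [p [pE pm] _] := minCpolyP (qeval h a).
pose f : {poly rat} := 'X^n - (m%:~R)%:P.
have fE c : qeval f c = c ^+ n - m%:~R.
  by rewrite /qeval rmorphB /= map_polyXn map_polyC !hornerE /= ratr_int.
have evM u v c : qeval (u * v) c = qeval u c * qeval v c.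
  by rewrite /qeval rmorphM hornerM.
have evD u v c : qeval (u + v) c = qeval u c + qeval v c.
  by rewrite /qeval rmorphD hornerD.
have evC c : qeval (p \Po h) c = (minCpoly (qeval h a)).[qeval h c].
  by rewrite /qeval map_comp_poly horner_comp pE.
have sf : size f = n.+1 by rewrite size_XnsubC.
have R0 : (p \Po h) %% f = 0.
  apply: (rat_poly_root_eq0 n m a) => //.
    by rewrite -ltnS -sf ltn_modp -size_poly_eq0 sf.
  have : qeval (p \Po h) a = 0.
    by rewrite evC; apply/eqP; exact: root_minCpoly.
  by rewrite {1}(divp_eq (p \Po h) f) evD evM fE am subrr mulr0 add0r.
apply: (@root_monic_Aint (minCpoly (qeval h a))).
- rewrite rootE -evC (divp_eq (p \Po h) f) R0 addr0 evM fE bm subrr mulr0 //.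
- exact: minCpoly_monic.
- by move: hA; rewrite unfold_in.
Qed.
(** For a root [b] of [X^n - a^n], the inner polynomial is [(X^n - b^n) / (X - b)]: it takes the
    value [n b^(n-1) = n a^n / b] at [b] and vanishes at the other roots. Both sides have degree
    below [n] and agree at [n] distinct points. *)
Lemma lagrange_pure (n : nat) (a z : algC) (p : {poly algC}) :
  (0 < n)%N -> a != 0 -> n.-primitive_root z -> (size p <= n)%N ->
  p = \sum_(i < n) (p.[z ^+ i * a] * (z ^+ i * a) / (n%:R * a ^+ n))
        *: \poly_(j < n) (z ^+ i * a) ^+ (n.-1 - j).
Proof.
move=> n0 a0 zP sp; apply/eqP; rewrite -subr_eq0; set S := \sum_(i < n) _.
have z0 : z != 0.
  apply/eqP=> zE; have := prim_expr_order zP.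
  by rewrite zE expr0n eqn0Ngt n0 => /esym/eqP; rewrite oner_eq0.
have bn i : (z ^+ i * a) ^+ n = a ^+ n.
  by rewrite exprMn -exprM mulnC exprM (prim_expr_order zP) expr1n mul1r.
pose rs : seq algC := [seq z ^+ i * a | i <- iota 0 n].
apply/eqP; apply: (@roots_geq_poly_eq0 _ _ rs).
- apply/allP=> _ /mapP[k + ->]; rewrite mem_iota add0n => /= kn.
  set b := z ^+ k * a.
  have b0 : b != 0 by rewrite mulf_neq0 // expf_neq0.
  rewrite rootE hornerD hornerN horner_sum (bigD1 (Ordinal kn)) //= -/b.
  rewrite big1 ?addr0 => [|i ik].
    rewrite hornerZ horner_poly.
    rewrite (eq_bigr (fun=> b ^+ n.-1)) => [|j _].
      rewrite sumr_const card_ord -[b ^+ _ *+ n]mulr_natl.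
      have -> : a ^+ n = b * b ^+ n.-1 by rewrite -exprS prednK // bn.
      rewrite subr_eq0 eq_sym; apply/eqP; field.
      by rewrite b0 expf_neq0 // pnatr_eq0 -lt0n n0.
    by rewrite -exprD subnK //; have := ltn_ord j; lia.
  rewrite hornerZ horner_poly; apply/eqP; rewrite mulf_eq0; apply/orP; right.
  (* Times this nonzero difference, the sum becomes a difference of equal [n]-th powers. *)
  have ib : z ^+ i * a - b != 0.
    rewrite subr_eq0 /b; apply/eqP=> /(mulIf a0)/eqP.
    rewrite (eq_prim_root_expr zP) !modn_small // => /eqP E.
    by case/eqP: ik; apply/val_inj.
  by rewrite -(mulrI_eq0 _ (mulfI ib)) -subrXX !bn subrr.
- rewrite map_inj_in_uniq ?iota_uniq // => i j; rewrite !mem_iota !add0n /= => im jn.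
  by move/(mulIf a0)/eqP; rewrite (eq_prim_root_expr zP) !modn_small // => /eqP.
rewrite size_map size_iota (leq_trans (size_polyD _ _)) // geq_max sp size_polyN.
apply: (leq_trans (size_sum _ _ _)); apply/bigmax_leqP=> i _.
by rewrite (leq_trans (size_scale_leq _ _)) // size_poly.
Qed.

(** * The modulus and the integrality of [W] *)

Lemma n0_ofE (n : nat) : (0 < n)%N -> n0_of n = (n * \prod_(p <- primes n) p)%N.
Proof.
move=> n0; rewrite {2}(prod_prime_decomp n0) prime_decompE big_map -big_split /=.
by apply: eq_bigr => p _; rewrite expnSr.
Qed.

Lemma prod_primes_gt0 (n : nat) : (0 < \prod_(p <- primes n) p)%N.
Proof.
rewrite big_seq; apply: prodn_cond_gt0 => p.
by rewrite mem_primes => /andP[/prime_gt0].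
Qed.

(* If [p ^ k] exactly divides [n], then [v_p('C(n, i)) >= k - v_p(i)], since [n]
   divides [i * 'C(n, i)], and [v_p(i) <= i - 1]. *)
Lemma dvdn_bin_rad (n i : nat) : (0 < n)%N -> (0 < i <= n)%N ->
  (n %| 'C(n, i) * (\prod_(p <- primes n) p) ^ i.-1)%N.
Proof.
move=> n0 /andP[i0 i_n]; set rad := (\prod_(p <- _) _)%N.
have rad0 : (0 < rad)%N := prod_primes_gt0 n.
have B0 : (0 < 'C(n, i))%N by rewrite bin_gt0.
have X0 : (0 < 'C(n, i) * rad ^ i.-1)%N by rewrite muln_gt0 B0 expn_gt0 rad0.
apply/dvdn_partP => // p; rewrite mem_primes => /and3P[pP _ pn].
rewrite p_part pfactor_dvdn // lognM ?expn_gt0 ?rad0 // lognX.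
have lr : (0 < logn p rad)%N.
  by rewrite -pfactor_dvdn // expn1 /rad (big_rem p) ?dvdn_mulr //= mem_primes pP n0.
have li : (logn p i <= i.-1)%N.
  rewrite -ltnS prednK //; apply: leq_trans (ltn_expl _ (prime_gt1 pP)) _.
  by apply: dvdn_leq; rewrite ?pfactor_dvdnn.
have : (logn p n <= logn p (i * 'C(n, i)))%N.
  apply: dvdn_leq_log; first by rewrite muln_gt0 i0.
  by rewrite -(prednK i0) -mul_bin_diag dvdn_mulr.
rewrite lognM //; have : (i.-1 <= i.-1 * logn p rad)%N by rewrite leq_pmulr.
lia.
Qed.

(* The [n]-th power of [a' * W = b * (W + R)] reads
   [(n R) W^n = a^n \sum_(i >= 1) 'C(n, i) R^i W^(n - i)]. *)
Lemma Aint_shift_quotient (n : nat) (m m' t : int) (b a' W : algC) :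
  (0 < n)%N -> b ^+ n = m%:~R -> a' ^+ n = m'%:~R -> m' = m + (n0_of n)%:Z * t -> t != 0 ->
  a' * W = b * (W + ((\prod_(p <- primes n) p)%N%:Z * t)%:~R) -> W \in Aint.
Proof.
move=> n0 bn an m'E t0; set rad := (\prod_(p <- _) _)%N; set R := rad%:Z * t => WE.
have rad0 : (0 < rad)%N := prod_primes_gt0 n.
have R0 : (R%:~R : algC) != 0.
  by rewrite intr_eq0 mulf_neq0 //; lia.
(* The coefficient of [W^(n - i)] once [n R] is cancelled; the integer division is exact for
   [0 < i <= n]. *)
pose c i : int := m * (('C(n, i) * rad ^ i.-1) %/ n)%N%:Z * t ^+ i.-1.
have cE i : (0 < i <= n)%N -> n%:Z * R * c i = m * ('C(n, i))%:Z * R ^+ i.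
  move=> /[dup] /andP[i0 _] /(dvdn_bin_rad n _ n0) dn.
  have E : n%:Z * (('C(n, i) * rad ^ i.-1) %/ n)%N%:Z = ('C(n, i))%:Z * rad%:Z ^+ i.-1.
    by rewrite -PoszM mulnC divnK // PoszM -!natz natrX.
  have -> : R ^+ i = R * R ^+ i.-1 by rewrite -exprS prednK.
  rewrite /c /R exprMn.
  transitivity (m * rad%:Z * t * t ^+ i.-1 * (n%:Z * (('C(n, i) * rad ^ i.-1) %/ n)%N%:Z)); first by ring.
  by rewrite E; ring.
have key : W ^+ n = \sum_(i < n) (c i.+1)%:~R * W ^+ (n - i.+1).
  have nR0 : (n%:Z * R)%:~R != 0 :> algC by rewrite rmorphM mulf_neq0 // intr_eq0; lia.
  apply: (mulfI nR0); rewrite mulr_sumr.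
  (* As [m' - m = n R], subtracting [m W^n] removes the term [i = 0] of the binomial expansion. *)
  transitivity (m'%:~R * W ^+ n - m%:~R * W ^+ n).
    by rewrite m'E n0_ofE // PoszM /R; rewrite !(rmorphD, rmorphM) /=; ring.
  rewrite -{1}an -exprMn WE exprMn bn exprDn mulr_sumr big_ord_recl /=.
  rewrite subn0 bin0 mulr1 mulr1n addrAC subrr add0r; apply: eq_bigr => i _.
  rewrite /bump /= add1n mulrA -rmorphM /= cE ?ltn_ord // !rmorphM /= -mulr_natr rmorphXn /=.
  by rewrite -pmulrn /R rmorphM /=; ring.
apply: (@root_monic_Aint ('X^n - \poly_(j < n) (c (n - j)%N)%:~R)).
- rewrite rootE !hornerE horner_poly key (reindex_inj rev_ord_inj) /= subr_eq0.
  apply/eqP/eq_bigr => i _; rewrite subnSK // subKn //; exact: ltnW.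
- rewrite monicE lead_coefDl ?lead_coefXn // size_polyN size_polyXn ltnS.
  exact: size_poly.
- apply/polyOverP => j; rewrite coefB coefXn coef_poly rpredB ?rpred_nat //.
  by case: ifP => _; rewrite ?rpred0 ?rpred_int.
Qed.

(** * Bounded denominators and transfer within a residue class *)

Lemma lagrange_qeval (n : nat) (m : int) (a z : algC) (h : {poly rat}) :
  (0 < n)%N -> a ^+ n = m%:~R -> m != 0 -> n.-primitive_root z -> (size h <= n)%N ->
  (n%:R * m%:~R) *: map_poly ratr h =
  \sum_(i < n) (qeval h (z ^+ i * a) * (z ^+ i * a))
    *: \poly_(j < n) (z ^+ i * a) ^+ (n.-1 - j).
Proof.
move=> n0 am m0 zP sh.
have nm0 : n%:R * m%:~R != 0 :> algC by rewrite mulf_neq0 ?intr_eq0 ?pnatr_eq0 -?lt0n.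
have a0 : a != 0.
  by apply: contraNneq m0 => aE; rewrite -(intr_eq0 algC) -am aE expr0n eqn0Ngt n0.
have sp : (size (map_poly ratr h : {poly algC}) <= n)%N by rewrite size_map_poly.
rewrite {1}(lagrange_pure n a z _ n0 a0 zP sp) scaler_sumr; apply: eq_bigr => i _.
by rewrite scalerA am mulrCA divff ?mulr1.
Qed.

Lemma conj_root (n : nat) (m : int) (a z : algC) (i : nat) :
  n.-primitive_root z -> a ^+ n = m%:~R -> (z ^+ i * a) ^+ n = m%:~R.
Proof.
by move=> zP am; rewrite exprMn -exprM mulnC exprM (prim_expr_order zP) expr1n mul1r.
Qed.

(** Interpolation writes [n m h_j] as a sum of products of algebraic integers; being rational, it is
    an integer. The bound does not depend on [h], which makes the integral [h] a lattice. *)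
Lemma coef_bounded_denom (n : nat) (m : int) (a : algC) (h : {poly rat}) :
  (0 < n)%N -> a ^+ n = m%:~R -> squarefree_int m -> m != 1 -> m != -1 ->
  (size h <= n)%N -> qeval h a \in Aint ->
  forall j, exists c : int, (n * `|m|)%N%:R * h`_j = c%:~R.
Proof.
move=> n0 am sqf m1 mN1 sh hA j.
have m0 := squarefree_neq0 _ sqf.
have [z zP] := C_prim_root_exists n0.
have Lg := lagrange_qeval n m a z h n0 am m0 zP sh.
have xA : (n%:R * m%:~R * ratr h`_j : algC) \in Aint.
  have -> : (n%:R * m%:~R * ratr h`_j : algC) = ((n%:R * m%:~R) *: map_poly ratr h : {poly algC})`_j.
    by rewrite coefZ coef_map.
  rewrite Lg coef_sum rpred_sum // => i _; rewrite coefZ coef_poly.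
  have bm := conj_root n m a z i zP am; have bA := Aint_int_root _ _ _ n0 bm.
  apply: rpredM; first by apply: rpredM => //; exact: (qeval_conj_Aint n m a).
  by case: ifP => _; rewrite ?rpred0 ?rpredX.
have /intrP[c cE] : (n%:R * m%:~R * ratr h`_j : algC) \is a Num.int.
  apply: Cint_rat_Aint xA; apply/CratP; exists (n%:R * m%:~R * h`_j).
  by rewrite !rmorphM /= ratr_nat ratr_int.
have cQ : n%:R * m%:~R * h`_j = c%:~R.
  apply: (fmorph_inj (@ratr algC)).
  by rewrite !rmorphM /= ratr_nat !ratr_int.
exists (c * Num.sg m); rewrite intrM -cQ natrM.
have -> : (`|m|%N%:R : rat) = m%:~R * (Num.sg m)%:~R.
  by rewrite -rmorphM mulrC -normrEsg -abszE.
by ring.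
Qed.

(* A prime dividing both [m] and [n] needs no separate treatment: Lagrange
   interpolation makes [m * qeval h a'] integral, and by the Eisenstein step some
   [D] coprime to [m] makes [D * qeval h a'] integral. *)
Lemma transfer_Aint (n : nat) (m m' : int) (a a' : algC) (h : {poly rat}) :
  (0 < n)%N -> a ^+ n = m%:~R -> a' ^+ n = m'%:~R ->
  squarefree_int m -> m != 1 -> m != -1 -> (m' = m %[mod (n0_of n)%:Z])%Z ->
  (size h <= n)%N -> qeval h a \in Aint -> qeval h a' \in Aint.
Proof.
move=> n0 am am' sqf m1 mN1 /eqP; rewrite eqz_mod_dvd => /dvdzP[t tE] sh hA.
have m'E : m' = m + (n0_of n)%:Z * t by rewrite [_ * t]mulrC -tE; ring.
(* For [t = 0] the number [a'] is a conjugate of [a]; otherwise [R] is nonzero, as the integrality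
   of [W] demands. *)
have [t0|t0] := eqVneq t 0.
  by apply: (qeval_conj_Aint n m a) => //; rewrite am' m'E t0 mulr0 addr0.
have m0 := squarefree_neq0 _ sqf.
have a'A := Aint_int_root _ _ _ n0 am'.
have [z zP] := C_prim_root_exists n0.
have mhA : m%:~R * qeval h a' \in Aint.
  have nC0 : n%:R != 0 :> algC by rewrite pnatr_eq0 -lt0n.
  (* The second factor is [W_i]: the inner sum is [(a'^n - b^n) / (a' - b) = n R / (a' - b)]. *)
  have -> : m%:~R * qeval h a' = \sum_(i < n) qeval h (z ^+ i * a) *
      ((z ^+ i * a) * (\sum_(j < n) (z ^+ i * a) ^+ (n.-1 - j) * a' ^+ j) / n%:R).
    apply: (mulfI nC0); rewrite mulrA -hornerZ (lagrange_qeval n m a z h n0 am m0 zP sh).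
    rewrite horner_sum mulr_sumr; apply: eq_bigr => i _; rewrite hornerZ horner_poly.
    by field.
  apply: rpred_sum => i _; have bm := conj_root n m a z i zP am.
  apply: rpredM; first exact: (qeval_conj_Aint n m a).
  set b := z ^+ i * a in bm *; set S := \sum_(j < n) _.
  apply: (Aint_shift_quotient n m m' t b a') => //.
  have SE : (b - a') * S = - (n%:Z * ((\prod_(p <- primes n) p)%N%:Z * t))%:~R.
    by rewrite -subrXX bm am' m'E n0_ofE // PoszM -rmorphB -rmorphN; congr (_%:~R); ring.
  have -> : a' * (b * S / n%:R) = b * (b * S / n%:R) - b / n%:R * ((b - a') * S) by ring.
  by rewrite SE rmorphM /= -pmulrn; field.
have [D [P cDm DE]] := rat_poly_coprime_denom n m a h n0 am sqf sh hA.
have DhA : D%:R * qeval h a' \in Aint.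
  rewrite -[D%:R](ratr_nat algC) -qeval_scale DE qeval_int horner_coef rpred_sum // => i _.
  by rewrite coef_map /= rpredM ?rpredX ?Aint_int.
have : coprimez D%:Z m by rewrite coprimezE.
(* Bezout: [D h(a')] and [m h(a')] are integral with [D] and [m] coprime. *)
move/coprimezP=> [[u v] /= uv].
have -> : qeval h a' = u%:~R * (D%:R * qeval h a') + v%:~R * (m%:~R * qeval h a').
  have : (u%:~R * D%:R + v%:~R * m%:~R : algC) = 1.
    by rewrite (pmulrn _ D) -!rmorphM -rmorphD uv.
  by move=> E; rewrite !mulrA -mulrDl E mul1r.
by rewrite rpredD // rpredM ?Aint_int.
Qed.

(** * Triangular bases of lattices of rational polynomials *)

Lemma minimal_nat (P : nat -> Prop) (k : nat) : P k ->
  exists2 j, P j & forall i, P i -> (j <= i)%N.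
Proof.
elim/ltn_ind: k => k IH Pk.
have [[j jk Pj]|H] := classic (exists2 j, (j < k)%N & P j); first exact: IH Pj.
exists k => // i Pi; rewrite leqNgt; apply/negP=> ik; apply: H; by exists i.
Qed.

Lemma lattice_scale (L : {poly rat} -> Prop) (c : int) (g : {poly rat}) :
  (forall g h, L g -> L h -> L (g - h)) -> L g -> L (c%:~R *: g).
Proof.
move=> LB Lg; have L0 : L 0 by rewrite -(subrr g); exact: LB.
have LD u v : L u -> L v -> L (u + v).
  by move=> Lu Lv; rewrite -[v]opprK -[- v]sub0r; apply: (LB) => //; exact: LB.
have Lk k : L (k%:R *: g).
  elim: k => [|k IH]; first by rewrite scale0r.
  by rewrite -addn1 natrD scalerDl scale1r; exact: LD.
case: c => k; first exact: Lk.
by rewrite NegzE rmorphN /= scaleNr -sub0r; apply: LB => //; apply: Lk.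
Qed.

(** The coefficients at degree [d] of the elements of degree at most [d] lie in [(1/N) Z]. An [e]
    with least positive coefficient there generates them all, by Euclidean division. *)
Lemma lattice_leading (n N d : nat) (L : {poly rat} -> Prop) :
  (0 < N)%N -> (forall g h, L g -> L h -> L (g - h)) ->
  (forall i, (i < n)%N -> L 'X^i) ->
  (forall h, L h -> forall j, exists c : int, N%:R * h`_j = c%:~R) -> (d < n)%N ->
  exists e, [/\ L e, size e = d.+1 &
    forall h, L h -> (size h <= d.+1)%N -> exists q : int, (size (h - q%:~R *: e)%R <= d)%N].
Proof.
move=> N_gt0 LB LX L_denom dn; pose P k := exists g,
  [/\ (0 < k)%N, L g, (size g <= d.+1)%N & N%:R * g`_d = k%:R].
have PN : P N by exists 'X^d; rewrite size_polyXn coefXn eqxx mulr1; split=> //; exact: LX.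
have [k [e [k0 Le se ek]] kmin] := minimal_nat P N PN.
have N0 : (N%:R : rat) != 0 by rewrite pnatr_eq0 -lt0n.
exists e; split=> //.
  apply/eqP; rewrite eqn_leq se /= ltnNge; apply/negP=> sd.
  by move: ek; rewrite nth_default // mulr0 => /esym/eqP; rewrite pnatr_eq0 -[_ == _]negbK -lt0n k0.
move=> h Lh sh; have [c cE] := L_denom h Lh d.
(* The remainder is again a numerator at degree [d], smaller than [k], so minimality makes it
   zero. *)
exists (c %/ k%:Z)%Z; set g := h - _.
have Lg : L g by apply: (LB) => //; exact: lattice_scale.
have sg : (size g <= d.+1)%N.
  rewrite (leq_trans (size_polyD _ _)) // geq_max sh size_polyN.
  exact: leq_trans (size_scale_leq _ _) se.
have gE : N%:R * g`_d = (c %% k%:Z)%Z%:~R.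
  rewrite coefB coefZ mulrBr mulrCA cE ek (pmulrn _ k) -rmorphM -rmorphB /=.
  by congr (_%:~R); rewrite {1}(divz_eq c k%:Z) addrC addKr.
have rk : (0 <= (c %% k%:Z)%Z < k%:Z)%R.
  by rewrite modz_ge0 ?ltz_pmod //; lia.
have [r rE] : exists r : nat, (c %% k%:Z)%Z = r%:Z.
  by exists `|(c %% k%:Z)%Z|%N; rewrite gez0_abs //; case/andP: rk.
have r0 : r = 0%N.
  apply/eqP/negPn/negP; rewrite -lt0n => r0.
  have : P r by exists g; split=> //; rewrite gE rE pmulrn.
  by move/kmin; move: rk; rewrite rE; lia.
apply/leq_sizeP => j; rewrite leq_eqVlt => /orP[/eqP <-|dj].
  by apply: (mulfI N0); rewrite gE rE r0 mulr0.
by rewrite nth_default // (leq_trans sg).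
Qed.

Lemma lattice_basis (n N : nat) (L : {poly rat} -> Prop) :
  (0 < N)%N -> (forall g h, L g -> L h -> L (g - h)) ->
  (forall i, (i < n)%N -> L 'X^i) ->
  (forall h, L h -> forall j, exists c : int, N%:R * h`_j = c%:~R) ->
  (forall h, L h -> (size h <= n)%N) ->
  exists e : 'I_n -> {poly rat},
    [/\ forall i, L (e i), forall i, size (e i) = i.+1 &
      forall h, L h -> exists c : 'I_n -> int, h = \sum_(i < n) (c i)%:~R *: e i].
Proof.
move=> N_gt0 LB LX L_denom Ln.
have /fin_all_exists[e eP] : forall i : 'I_n, exists e, [/\ L e, size e = i.+1 &
    forall h, L h -> (size h <= i.+1)%N -> exists q : int, (size (h - q%:~R *: e)%R <= i)%N].
  by move=> i; apply: (lattice_leading n N).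
exists e; split=> [i|i|h Lh]; [by case: (eP i) | by case: (eP i) |].
have := Ln h Lh; have : (n <= n)%N by [].
(* Only the size bound varies; the index type of the basis stays ['I_n]. *)
elim: {1 3}n h Lh => [|d IH] h Lh dn sh.
  exists (fun=> 0); move: sh; rewrite leqn0 size_poly_eq0 => /eqP ->.
  by rewrite big1 // => i _; rewrite scale0r.
have [Le _ /(_ h Lh sh)[q sq]] := eP (Ordinal dn).
have [c cE] := IH _ (LB _ _ Lh (lattice_scale _ q _ LB Le)) (ltnW dn) sq.
exists (fun i => c i + (if i == Ordinal dn then q else 0)).
under eq_bigr do rewrite rmorphD scalerDl.
rewrite big_split /= -cE (bigD1 (Ordinal dn)) //= eqxx big1 ?addr0 ?subrK //.
by move=> i /negPf ->; rewrite scale0r.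
Qed.

Lemma size_graded_free (n : nat) (e : 'I_n -> {poly rat}) (c : 'I_n -> int) :
  (forall i, size (e i) = i.+1) -> \sum_(i < n) (c i)%:~R *: e i = 0 ->
  forall i, c i = 0.
Proof.
(* Downward induction on the index: at coefficient [i], later terms vanish by induction and earlier
   ones have too small a degree. *)
move=> se E; suff H k (i : 'I_n) : (n <= i + k)%N -> c i = 0.
  by move=> i; apply: (H n); rewrite leq_addl.
elim: k i => [|k IH] i ik; first by have := ltn_ord i; lia.
have := congr1 (fun p : {poly rat} => p`_i) E; rewrite coef0 coef_sum (bigD1 i) //= coefZ.
rewrite big1 ?addr0 => [/eqP|j ji]; last first.
  rewrite coefZ; case: (ltngtP i j) => [ij|ij|/val_inj ij]; last by rewrite ij eqxx in ji.
    by rewrite IH ?mul0r //; lia.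
  by rewrite [_`_i]nth_default ?mulr0 // se.
have : lead_coef (e i) != 0 by rewrite lead_coef_eq0 -size_poly_eq0 se.
by rewrite lead_coefE se /= mulf_eq0 => /negPf ->; rewrite orbF intr_eq0 => /eqP.
Qed.

(** * Assembling the periodic basis *)

Lemma qeval_sum (n : nat) (e : 'I_n -> {poly rat}) (c : 'I_n -> int) (a : algC) :
  qeval (\sum_(i < n) (c i)%:~R *: e i) a = \sum_(i < n) (c i)%:~R * qeval (e i) a.
Proof.
rewrite {1}/qeval rmorph_sum horner_sum; apply: eq_bigr => i _.
by rewrite -/(qeval _ a) qeval_scale ratr_int.
Qed.

Lemma qeval_reduce (n : nat) (m : int) (a : algC) (g : {poly rat}) :
  (0 < n)%N -> a ^+ n = m%:~R ->
  exists2 h : {poly rat}, (size h <= n)%N & qeval h a = qeval g a.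
Proof.
move=> n0 am; pose f : {poly rat} := 'X^n - (m%:~R)%:P.
have sf : size f = n.+1 by rewrite size_XnsubC.
exists (g %% f); first by rewrite -ltnS -sf ltn_modp -size_poly_eq0 sf.
rewrite [in RHS](divp_eq g f) /qeval rmorphD rmorphM /= hornerD hornerM.
by rewrite rmorphB /= map_polyXn map_polyC !hornerE /= ratr_int am subrr mulr0 add0r.
Qed.

Theorem theorem4p3 (n : nat) (hn : (2 <= n)%N) :
  forall r : int,
  exists h : 'I_n -> {poly rat},
  forall m : int, squarefree_int m -> m != 1 -> m != -1 ->
    (m = r %[mod (n0_of n)%:Z])%Z ->
  forall a : algC, root ('X^n - (m%:~R)%:P) a ->
    integral_basis a (fun i => qeval (h i) a).
Proof.
move=> r; have n0 : (0 < n)%N by exact: ltnW.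
(* One admissible [m] of the class supplies the basis for all; in a class without any, every choice
   of [h] will do. *)
have [[m [sqf m1 mN1 mr]]|none] := classic (exists m : int,
    [/\ squarefree_int m, m != 1, m != -1 & (m = r %[mod (n0_of n)%:Z])%Z]); last first.
  by exists (fun=> 0) => m sqf m1 mN1 mr; case: none; exists m.
pose a : algC := n.-root m%:~R; have am : a ^+ n = m%:~R by rewrite rootCK.
pose L (h : {poly rat}) := (size h <= n)%N /\ qeval h a \in Aint.
have qevalB u v c : qeval (u - v) c = qeval u c - qeval v c.
  by rewrite /qeval rmorphB hornerD hornerN.
have aA := Aint_int_root _ _ _ n0 am.
have [e [Le se spanL]] : exists e : 'I_n -> {poly rat},
    [/\ forall i, L (e i), forall i, size (e i) = i.+1 &
      forall h, L h -> exists c : 'I_n -> int, h = \sum_(i < n) (c i)%:~R *: e i].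
  apply: (@lattice_basis n (n * `|m|)%N L).
  - by rewrite muln_gt0 n0 lt0n absz_eq0 squarefree_neq0.
  - move=> u v [su uA] [sv vA]; split; last by rewrite qevalB rpredB.
    by rewrite (leq_trans (size_polyD _ _)) // geq_max su size_polyN.
  - move=> i i_n; rewrite /L size_polyXn; split=> //.
    by rewrite /qeval map_polyXn hornerXn rpredX.
  - by move=> u [su uA]; apply: (coef_bounded_denom n m a).
  - by move=> u [].
exists e => m' sqf' m1' mN1' mr' a' ra'.
have am' : a' ^+ n = m'%:~R.
  by move: ra'; rewrite rootE !hornerE subr_eq0 => /eqP.
have mm' : (m' = m %[mod (n0_of n)%:Z])%Z by rewrite mr mr'.
split.
- move=> i; have [si iA] := Le i; split; first by exists (e i).
  exact: (transfer_Aint n m m' a a').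
(* Spanning: reduce modulo [X^n - m'], then transfer back from [a'] to [a] to land in [L]. *)
- move=> _ [g ->] gA; have [h sh hg] := qeval_reduce n m' a' g n0 am'.
  have [|c cE] := spanL h; last by exists c; rewrite -hg cE qeval_sum.
  by split=> //; apply: (transfer_Aint n m' m a' a) => //; rewrite hg.
(* A relation at [a'] comes from a polynomial of degree below [n], which must vanish; the distinct
   degrees of the [e i] finish. *)
- move=> c; rewrite -qeval_sum => cE; apply: (size_graded_free n e c se).
  apply: (rat_poly_root_eq0 n m' a') => //.
  apply: (leq_trans (size_sum _ _ _)); apply/bigmax_leqP=> i _.
  by rewrite (leq_trans (size_scale_leq _ _)) // se.
Qed.
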